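(* Let $p>1$ and let $f,F$ be real numbers with $f>0$ and $f^p\le F$. Let $c=\omega_p(f^p/F)$. Let $(g_n)_{n\in\mathbb{N}}$ be a sequence of non-increasing continuous functions $g_n:(0,1]\to\mathbb{R}^+$ such that $\int_0^1 g_n(u)\,du=f$ and $\int_0^1 g_n^p(u)\,du=F$ for every $n\in\mathbb{N}$. Then the following are equivalent: (i) $\displaystyle\lim_{n}\int_0^1\Big(\frac1t\int_0^t g_n(u)\,du\Big)^p dt=F\,\omega_p(f^p/F)^p$; (ii) $\displaystyle\lim_{n}\int_0^1\Big|\frac1t\int_0^t g_n(u)\,du-c\,g_n(t)\Big|^p dt=0$.
   Context: $\mathbb{R}^+$ denotes the non-negative real numbers. For $p>1$, $\omega_p:[0,1]\to\big[1,\frac{p}{p-1}\big]$ denotes the inverse function $H_p^{-1}$ of $H_p:\big[1,\frac{p}{p-1}\big]\to[0,1]$, $H_p(z)=-(p-1)z^p+pz^{p-1}$ (a strictly decreasing bijection). *)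

(* Defs.v *)
From mathcomp Require Import all_boot all_order all_algebra.
From mathcomp Require Import all_classical all_reals all_analysis.
Import Order.TTheory GRing.Theory Num.Theory numFieldNormedType.Exports.

Set Implicit Arguments.
Unset Strict Implicit.
Unset Printing Implicit Defensive.

Local Open Scope classical_set_scope.
Local Open Scope ring_scope.

Definition Hp {R : realType} (p z : R) : R :=
  - (p - 1) * z `^ p + p * z `^ (p - 1).

(* [pinv A f] is the inverse of the restriction of [f] to [A]; for [1 < p] the
   restriction below is a bijection onto [0, 1], and only the values of
   [omega p] on [0, 1] are meaningful. *)
Definition omega {R : realType} (p : R) : R -> R :=
  pinv `[1, p / (p - 1)] (Hp p).

(* The average of [g] over (0, t], for [0 < t]. The integral is [fine]
   of the Lebesgue integral, hence the true one whenever [g] is integrable. *)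
Definition average {R : realType} (g : R -> R) (t : R) : R :=
  t^-1 * \int[lebesgue_measure]_(u in `]0, t]) g u.

(* Main.v *)
Require Import Defs.
From mathcomp Require Import all_boot all_order all_algebra.
From mathcomp Require Import all_classical all_reals all_analysis.
From mathcomp Require Import measurable_realfun ring lra.
Import Order.TTheory GRing.Theory Num.Theory numFieldNormedType.Exports.
Local Open Scope classical_set_scope.
Local Open Scope ring_scope.

(* Let A be the average of g and D(x, y) = x^p - y^p - p y^(p-1) (x - y) >= 0
   the Bregman divergence of x^p. Since (t A^p)' = p A^(p-1) g - (p-1) A^p,
     D(c g, A) + (c-1)(p-1) A^p = c^p g^p - c (t A^p)'
   pointwise, and integrating over (0, 1] gives
     int D(c g, A) + (c-1)(p-1) int A^p = c^p F - c f^p = (c-1)(p-1) c^p F,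
   the last step being H_p(c) = f^p / F. Hence (i) forces int D(c g_n, A_n) -> 0,
   and |a - b|^p <= e (a^p + b^p) + C_e D(b, a) turns this into (ii).
   Conversely a^p <= (1 + e) b^p + C_e |a - b|^p, applied to (A_n, c g_n) and to
   (c g_n, A_n), shows that int A_n^p and c^p F have the same limit under (ii). *)

(** * The Bregman divergence of x^p and elementary inequalities for p-th powers *)

Section bregman.
Context {R : realType}.
Variable p : R.
Hypothesis p_gt1 : 1 < p.
Implicit Types a b r s x y z e : R.

Let p_gt0 : 0 < p. Proof. by move: p_gt1; lra. Qed.
Let p1_gt0 : 0 < p - 1. Proof. by move: p_gt1; lra. Qed.

Definition bregman x y : R := x `^ p - y `^ p - p * y `^ (p - 1) * (x - y).

Lemma ltr_ln_subr1 x : 0 < x -> x != 1 -> ln x < x - 1.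
Proof.
move=> x0 x1; rewrite -ltr_expR lnK ?posrE//.
by have := @expR_gt1Dx _ (x - 1); rewrite subr_eq0 => /(_ x1); rewrite addrC subrK.
Qed.

Lemma ler_ln_subr1 x : 0 < x -> ln x <= x - 1.
Proof.
move=> x0; have [->|x1] := eqVneq x 1; first by rewrite ln1 subrr.
exact/ltW/ltr_ln_subr1.
Qed.

(** Nontrivial only when the left side w is positive, and then logarithms are compared. Strictness
    comes from ln x < x - 1 at x = 1/s, which differs from 1. *)
Lemma bernoulli_powR_lt s : 0 <= s -> s != 1 -> 1 + p * (s - 1) < s `^ p.
Proof.
rewrite le_eqVlt => /predU1P[<- _|s0 s1].
  by rewrite powR0 ?gt_eqF// sub0r mulrN1 subr_lt0.
set w := 1 + p * (s - 1).
have [w0|w0] := leP w 0; first exact: le_lt_trans w0 (powR_gt0 _ s0).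
rewrite -ltr_ln ?posrE ?powR_gt0// ln_powR.
(* Concavity of [ln] at [s = w / p + (1 - 1 / p)], through the tangent at [s]. *)
have lnw : ln w <= ln s + (w / s - 1).
  rewrite -[leLHS](_ : ln s + ln (w / s) = _) ?lerD2l ?ler_ln_subr1 ?divr_gt0//.
  by rewrite ln_div ?posrE// addrC subrK.
have ln1s : - ln s < s^-1 - 1.
  rewrite -lnV ?posrE// ltr_ln_subr1 ?invr_gt0//.
  by rewrite invr_eq1.
have H : w / s - 1 = - (p - 1) * (s^-1 - 1).
  by rewrite /w; field; rewrite gt_eqF.
apply: le_lt_trans lnw _; rewrite H.
have : (p - 1) * (- ln s) < (p - 1) * (s^-1 - 1) by rewrite ltr_pM2l.
lra.
Qed.

Lemma bregman_homo r x y : 0 <= r -> 0 <= x -> 0 <= y ->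
  bregman (r * x) (r * y) = r `^ p * bregman x y.
Proof.
move=> r0 x0 y0; rewrite /bregman !powRM// -(mulr_powRB1 r0 p_gt0).
ring.
Qed.

(** For y > 0, homogeneity scales y to 1, where the divergence is the gap in Bernoulli's inequality
    at s = x / y. For y = 0 both powers of y vanish, as p and p - 1 are nonzero, and x^p remains. *)
Lemma bregman_gt0 x y : 0 <= x -> 0 <= y -> x != y -> 0 < bregman x y.
Proof.
move=> x0; rewrite le_eqVlt => /predU1P[<- xn0|y0 xy].
  rewrite /bregman !powR0 ?gt_eqF// mulr0 mul0r !subr0 powR_gt0//.
  by rewrite lt_neqAle eq_sym xn0.
have -> : x = y * (x / y) by rewrite mulrC divfK ?gt_eqF.
rewrite -[Y in bregman _ Y]mulr1 bregman_homo ?(ltW y0) ?divr_ge0 ?(ltW y0)//.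
rewrite mulr_gt0 ?powR_gt0// /bregman !powR1 mulr1.
have s1 : x / y != 1 by apply: contraNneq xy => /divr1_eq ->.
have := bernoulli_powR_lt _ (divr_ge0 x0 (ltW y0)) s1; lra.
Qed.

Lemma bregman_ge0 x y : 0 <= x -> 0 <= y -> 0 <= bregman x y.
Proof.
move=> x0 y0; have [->|xy] := eqVneq x y; last exact/ltW/bregman_gt0.
by rewrite /bregman !subrr mulr0 subr0.
Qed.

(* The remainder of the three-point identity is a product of two differences of
   the same sign. *)
Lemma bregman_between x y z : 0 <= x -> 0 <= y -> 0 <= z ->
  (x <= y <= z) || (z <= y <= x) ->
  bregman x y + bregman y z <= bregman x z.
Proof.
move=> x0 y0 z0 xyz; rewrite -subr_ge0.
have -> : bregman x z - (bregman x y + bregman y z) =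
    p * ((y `^ (p - 1) - z `^ (p - 1)) * (x - y)) by rewrite /bregman; ring.
rewrite mulr_ge0// ?(ltW p_gt0)//.
have mono u v : 0 <= u -> 0 <= v -> u <= v -> u `^ (p - 1) <= v `^ (p - 1).
  by move=> u0 v0 uv; apply: ge0_ler_powR => //; rewrite ?nnegrE// ltW.
case/orP: xyz => /andP[h1 h2].
  by rewrite mulr_le0// subr_le0// mono.
by rewrite mulr_ge0// subr_ge0// mono.
Qed.

(** With r = 1 - e, either one of a, b is at most r times the other, and the divergence dominates
    the p-th power of the larger one, or |a - b| is at most e times the larger one. *)
Lemma distr_powR_le_bregman e : 0 < e -> exists2 C, 0 < C &
  forall a b, 0 <= a -> 0 <= b ->
    `|a - b| `^ p <= e * (a `^ p + b `^ p) + C * bregman b a.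
Proof.
(* A smaller e gives a stronger bound, so e is replaced by the minimum of e and 1/2. *)
wlog e1 : e / e < 1 => [wlg e0|e0].
  have [||C C0 HC] := wlg (Num.min e 2^-1).
  - by rewrite gt_min [X in _ || X]invf_lt1 ?ltr1n ?orbT.
  - by rewrite lt_min e0 invr_gt0 ltr0n.
  exists C => // a b a0 b0; apply: le_trans (HC _ _ a0 b0) _.
  by rewrite lerD2r ler_wpM2r ?addr_ge0 ?powR_ge0// ge_min lexx.
pose r := 1 - e.
have r0 : 0 < r by rewrite subr_gt0.
have r1 : r != 1 by rewrite /r; apply/eqP => ?; lra.
have rle1 : r <= 1 by rewrite /r; lra.
(* The divergences at the threshold ratio r. Both orders occur because the divergence is not
   symmetric; C is the sum of their inverses, so it serves either case. *)
have d1 : 0 < bregman r 1 by rewrite bregman_gt0// ltW.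
have d2 : 0 < bregman 1 r by rewrite bregman_gt0 1?eq_sym// ltW.
have Cgt0 : 0 < (bregman r 1)^-1 + (bregman 1 r)^-1 by rewrite addr_gt0 ?invr_gt0.
exists ((bregman r 1)^-1 + (bregman 1 r)^-1) => // a b a0 b0.
have pa := powR_ge0 a p; have pb := powR_ge0 b p.
have dab := bregman_ge0 _ _ b0 a0.
have mono u v : 0 <= u -> 0 <= v -> u <= v -> u `^ p <= v `^ p.
  by move=> u0 v0 uv; apply: ge0_ler_powR => //; rewrite ?nnegrE// ltW.
have eab : 0 <= e * (a `^ p + b `^ p) by rewrite mulr_ge0 ?addr_ge0// ltW.
have [bra|rab] := leP b (r * a).
  have ra : r * a <= a by rewrite ler_piMl.
  rewrite (@le_trans _ _ (a `^ p))//.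
    apply: mono => //; rewrite ger0_norm ?gerBl// subr_ge0.
    exact: le_trans bra ra.
  (* Since r * a lies between b and a, moving b up to r * a can only decrease the divergence from a;
     homogeneity then extracts a^p. *)
  have : a `^ p * bregman r 1 <= bregman b a.
    rewrite -bregman_homo ?(ltW r0)// mulr1 mulrC.
    have ra0 : 0 <= r * a by rewrite mulr_ge0 ?(ltW r0).
    apply: le_trans (bregman_between _ _ _ b0 ra0 a0 _); last by rewrite bra ra.
    by rewrite lerDr bregman_ge0.
  rewrite -ler_pdivlMr// => h; rewrite mulrDl.
  have : 0 <= (bregman 1 r)^-1 * bregman b a by rewrite mulr_ge0// invr_ge0 ltW.
  by move: h eab; lra.
have [arb|rba] := leP a (r * b).
  have rb : r * b <= b by rewrite ler_piMl.
  rewrite (@le_trans _ _ (b `^ p))//.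
    apply: mono => //; rewrite distrC ger0_norm ?gerBl// subr_ge0.
    exact: le_trans arb rb.
  have : b `^ p * bregman 1 r <= bregman b a.
    rewrite -bregman_homo ?(ltW r0)// mulr1 (mulrC b).
    have rb0 : 0 <= r * b by rewrite mulr_ge0 ?(ltW r0).
    apply: le_trans (bregman_between _ _ _ b0 rb0 a0 _).
      by rewrite lerDl bregman_ge0.
    by rewrite arb rb orbT.
  rewrite -ler_pdivlMr// => h; rewrite mulrDl.
  have : 0 <= (bregman r 1)^-1 * bregman b a by rewrite mulr_ge0// invr_ge0 ltW.
  by move: h eab; lra.
(* Remaining case: each number exceeds r times the other, so |a - b| <= e max(a, b), and e^p <= e
   because e < 1 < p. *)
rewrite (@le_trans _ _ (e * (a `^ p + b `^ p)))//; last first.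
  by rewrite lerDl mulr_ge0// ltW.
have ep : e `^ p <= e by rewrite ge1r_powR ?(ltW p_gt1)// e0 ltW.
have [ab|ba] := leP a b.
- rewrite (@le_trans _ _ ((e * b) `^ p))//.
    apply: mono; rewrite ?mulr_ge0 ?(ltW e0)//.
    by rewrite distrC ger0_norm ?subr_ge0//; move: rba; rewrite /r; lra.
  rewrite powRM ?(ltW e0)// ler_pM ?powR_ge0// ler_wpDl//.
- rewrite (@le_trans _ _ ((e * a) `^ p))//.
    apply: mono; rewrite ?mulr_ge0 ?(ltW e0)//.
    by rewrite ger0_norm ?subr_ge0 ?(ltW ba)//; move: rab; rewrite /r; lra.
  by rewrite powRM ?(ltW e0)// ler_pM ?powR_ge0// ler_wpDr.
Qed.

(** Choose k > 0 with (1 + k)^p = 1 + e. If |a - b| <= k b, then a <= (1 + k) b; otherwise b < |a -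
    b| / k, and a <= (1/k + 1) |a - b|. *)
Lemma powR_le_distr e : 0 < e -> exists2 C, 0 < C &
  forall a b, 0 <= a -> 0 <= b ->
    a `^ p <= (1 + e) * b `^ p + C * `|a - b| `^ p.
Proof.
move=> e0; pose k := (1 + e) `^ p^-1 - 1.
have mono u v : 0 <= u -> 0 <= v -> u <= v -> u `^ p <= v `^ p.
  by move=> u0 v0 uv; apply: ge0_ler_powR => //; rewrite ?nnegrE// ltW.
have k1 : (1 + k) `^ p = 1 + e.
  by rewrite /k subrKC -powRrM mulVf ?gt_eqF// powRr1//; lra.
have k0 : 0 < k.
  have : 1 `^ p^-1 < (1 + e) `^ p^-1.
    by apply: gt0_ltr_powR; rewrite ?invr_gt0// ?nnegrE//; lra.
  by rewrite powR1 subr_gt0.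
exists ((k^-1 + 1) `^ p); first by rewrite powR_gt0// addr_gt0 ?invr_gt0.
move=> a b a0 b0.
have h1 : 0 <= (1 + e) * b `^ p by rewrite mulr_ge0 ?powR_ge0//; lra.
have h2 : 0 <= (k^-1 + 1) `^ p * `|a - b| `^ p by rewrite mulr_ge0 ?powR_ge0.
have aab : a <= b + `|a - b| by rewrite -lerBlDl ler_norm.
have [dk|kd] := leP `|a - b| (k * b).
  apply: (@le_trans _ _ ((1 + e) * b `^ p)); last by rewrite lerDl.
  rewrite -k1 -powRM//; last lra.
  by apply: mono => //; [rewrite mulr_ge0//; lra|lra].
apply: (@le_trans _ _ ((k^-1 + 1) `^ p * `|a - b| `^ p)); last by rewrite lerDr.
have ki : 0 <= k^-1 + 1 by rewrite addr_ge0// invr_ge0 ltW.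
rewrite -powRM//; apply: mono; rewrite ?mulr_ge0//.
apply: (le_trans aab); rewrite mulrDl mul1r lerD2r.
by rewrite mulrC ler_pdivlMr// mulrC ltW.
Qed.

End bregman.

(** * Splitting and exhausting integrals over half-open intervals *)

Section splitting.
Context {R : realType}.
Local Notation mu := (@lebesgue_measure R).
Local Open Scope ereal_scope.

Lemma integral_split (h : R -> \bar R) (a t b : R) : (a < t)%R -> (t <= b)%R ->
  measurable_fun `]a, b] h -> (forall u, u \in `]a, b] -> 0 <= h u) ->
  \int[mu]_(u in `]a, b]) h u =
  \int[mu]_(u in `]a, t]) h u + \int[mu]_(u in `]t, b]) h u.
Proof.
move=> at_ tb mh h0; have ab : `]a, b]%classic = `]a, t] `|` `]t, b] :> set R.
  by rewrite -itv_bndbnd_setU// bnd_simp// ltW.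
rewrite [in LHS]ab ge0_integral_setU//.
- by rewrite -ab.
- by move=> u; rewrite -ab; exact: h0.
- apply/disj_setPLR => u /=; rewrite !in_itv/= => /andP[_ ut].
  by rewrite ltNge ut.
Qed.

(** Monotone convergence along an exhaustion of ]0, 1[; the point 1 left out is a null set. This
    serves to apply the fundamental theorem of calculus strictly inside ]0, 1[, as the function may
    blow up at 0 and is only left-continuous at 1. *)
Lemma cvg_integral_oo01 (e : R^nat) (h : R -> \bar R) :
  (forall n, 0 < e n)%R -> nonincreasing_seq e -> e @ \oo --> 0%R ->
  measurable_fun `](0%R : R), 1%R] h ->
  (forall u, u \in `](0%R : R), 1%R] -> 0 <= h u) ->
  \int[mu]_(u in `](e n), (1 - e n)%R]) h u @[n --> \oo] -->
  \int[mu]_(u in `]0%R, 1%R]) h u.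
Proof.
move=> e0 e_noninc e_cvg mh h0.
have sub n : `](e n), (1 - e n)%R] `<=` `](0%R : R), 1%R].
  by apply: subset_itv; rewrite bnd_simp ?gerBl ltW.
rewrite -integral_itv_bndo_bndc//; last first.
  exact/emeasurable_fun_itv_bndo_bndcP.
have -> : `]0%R, 1%R[%classic =
    \bigcup_n `](e n), (1 - e n)%R]%classic :> set R.
  apply/seteqP; split=> [t /=|t [n _] /=]; rewrite !in_itv/=; last first.
    by move=> /andP[tn tn1]; rewrite (lt_trans _ tn)// (le_lt_trans tn1)// gtrBl.
  move=> /andP[t0 t1].
  near \oo => n; exists n => //=; rewrite in_itv/=.
  have : (e n < Num.min t (1 - t))%R.
    by near: n; apply: (cvgr_lt 0%R) => //; rewrite lt_min t0 subr_gt0.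
  by rewrite lt_min => /andP[-> ?]; lra.
apply: ge0_nondecreasing_set_cvg_integral => //=.
- move=> m n mn; rewrite subsetEset; have mn' := e_noninc _ _ mn.
  by apply: subset_itv; rewrite bnd_simp ?lerD2l ?lerN2.
- by move=> n; apply: measurable_funS mh.
- by move=> n u /sub; exact: h0.
Unshelve. all: by end_near. Qed.

End splitting.

(** * A single function g: its primitive S and its average A *)

Section hardy_identity.
Context {R : realType}.
Variables (p f F : R) (g : R -> R).
Local Notation mu := (@lebesgue_measure R).
Hypothesis p_gt1 : 1 < p.
Hypothesis f_gt0 : 0 < f.
Hypothesis g_ge0 : forall t, t \in `]0, 1] -> 0 <= g t.
Hypothesis g_noninc : {in `]0, 1] &, {homo g : x y /~ x <= y}}.
Hypothesis g_cont : {within `]0, 1], continuous g}.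
Hypothesis int_g : (\int[mu]_(u in `]0%R, 1%R]) (g u)%:E)%E = f%:E.
Hypothesis int_gp : (\int[mu]_(u in `]0%R, 1%R]) (g u `^ p)%:E)%E = F%:E.
Implicit Types t a b c : R.

Let p_gt0 : 0 < p. Proof. by move: p_gt1; lra. Qed.

Let S t := \int[mu]_(u in `]0, t]) g u.

Let A := average g.

Let sub01 t : t <= 1 -> `]0, t] `<=` `]0, 1].
Proof. by move=> t1; apply: subset_itvl; rewrite bnd_simp. Qed.

Let mg : measurable_fun `](0 : R), 1] g.
Proof. exact: subspace_continuous_measurable_fun. Qed.

Let ig : mu.-integrable `](0 : R), 1] (EFin \o g).
Proof.
apply/integrableP; split; first exact/measurable_EFinP.
rewrite (_ : integral _ _ _ = f%:E) ?ltry// -int_g.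
apply: eq_integral => u /set_mem u01 /=.
by rewrite ger0_norm// g_ge0.
Qed.

Let igp : mu.-integrable `](0 : R), 1] (fun t => (g t `^ p)%:E).
Proof.
apply/integrableP; split.
  exact/measurable_EFinP/(measurableT_comp (measurable_powR _)).
rewrite (_ : integral _ _ _ = F%:E) ?ltry// -int_gp.
apply: eq_integral => u _ /=.
by rewrite ger0_norm// powR_ge0.
Qed.

Let SE t : t <= 1 -> (S t)%:E = (\int[mu]_(u in `]0%R, t]) (g u)%:E)%E.
Proof.
move=> t1; rewrite /S /Rintegral fineK// integrable_fin_num//.
by apply: integrableS ig => //; exact: sub01.
Qed.

(** If g t > 0, monotonicity gives S t >= t * g t. If g t = 0, then g vanishes on ]t, 1] and S t is
    the whole integral f > 0. Positivity makes the real powers of S and A differentiable. *)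
Let S_gt0 t : t \in `]0, 1] -> 0 < S t.
Proof.
rewrite in_itv/= => /andP[t0 t1].
have t01 : t \in `]0, 1] by rewrite in_itv/= t0.
rewrite -lte_fin SE//.
have gt_le : ((t * g t)%:E <= \int[mu]_(u in `]0%R, t]) (g u)%:E)%E.
  rewrite -[leLHS](_ : (\int[mu]_(u in `]0%R, t]) (cst (g t)%:E u))%E = _).
    apply: ge0_le_integral => //=.
    - by move=> u _; rewrite lee_fin g_ge0.
    - apply/measurable_EFinP; by apply: measurable_funS mg => //; exact: sub01.
    - move=> u; rewrite in_itv/= => /andP[u0 ut]; rewrite lee_fin.
      by apply: g_noninc; rewrite // in_itv/= u0 (le_trans ut).
  rewrite integral_cst//= lebesgue_measure_itv/= lte_fin t0.
  by rewrite oppr0 adde0 -EFinM mulrC.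
have := g_ge0 _ t01; rewrite le_eqVlt => /predU1P[gt0|gt0]; last first.
  by apply: lt_le_trans gt_le; rewrite lte_fin mulr_gt0.
suff <- : (\int[mu]_(u in `]0%R, 1%R]) (g u)%:E =
    \int[mu]_(u in `]0%R, t]) (g u)%:E)%E by rewrite int_g lte_fin.
rewrite (integral_split _ _ _ _ t0 t1)//; last exact/measurable_EFinP.
rewrite [X in (_ + X)%E]integral0_eq ?adde0// => u /=.
rewrite in_itv/= => /andP[tu u1]; congr (_%:E); apply/eqP.
have u01 : u \in `]0, 1] by rewrite in_itv/= u1 (lt_trans t0 tu).
by rewrite eq_le g_ge0// andbT gt0 g_noninc// ltW.
Qed.


Let g_cont_at t : t \in `]0, 1[ -> {for t, continuous g}.
Proof.
move=> t01; have : {within `]0, 1[, continuous g}.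
  by apply: continuous_subspaceW g_cont; apply: subset_itvl; rewrite bnd_simp.
rewrite continuous_open_subspace; last exact: interval_open.
by apply; rewrite inE.
Qed.

Let is_derive_S t : t \in `]0, 1[ -> is_derive t 1 S (g t).
Proof.
move=> t01; move: (t01); rewrite in_itv/= => /andP[t0 t1].
have [dS S't] := @continuous_FTC1 R g (BRight 0) t 1 t1 ig t0 (g_cont_at t t01).
rewrite -[g t]S't derive1E; exact: DeriveDef.
Qed.

(** * The boundary function t A^p and its derivative *)

Let Phi t := t * A t `^ p.

(** This product form separates the power of t from the power of S, so that the product and chain
    rules apply directly. *)
Let PhiE t : t \in `]0, 1] -> Phi t = t `^ (1 - p) * S t `^ p.
Proof.
move=> t01; have St := ltW (S_gt0 _ t01).
move: t01; rewrite in_itv/= => /andP[t0 t1].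
rewrite /Phi /A /average powRM ?invr_ge0 ?(ltW t0)// -/(S t) mulrA; congr (_ * _).
rewrite powRB ?(gt_eqF t0) ?implybT// powRr1 ?(ltW t0)//.
by rewrite -[X in X `^ p]powR_inv1 ?(ltW t0)// -powRrM mulN1r powRN.
Qed.

Let A_gt0 t : t \in `]0, 1] -> 0 < A t.
Proof.
move=> t01; rewrite mulr_gt0 ?S_gt0// invr_gt0.
by move: t01; rewrite in_itv/= => /andP[].
Qed.

Let sub_oo t : t \in `]0, 1[ -> t \in `]0, 1].
Proof. by rewrite !in_itv/= => /andP[-> /ltW]. Qed.

Let dPhi t := p * (A t `^ (p - 1) * g t) - (p - 1) * A t `^ p.

Let is_derive_Phi t : t \in `]0, 1[ -> is_derive t 1 Phi (dPhi t).
Proof.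
move=> t01; have St := S_gt0 _ (sub_oo _ t01).
have At := A_gt0 _ (sub_oo _ t01).
have t0 : 0 < t by move: t01; rewrite in_itv/= => /andP[].
have dS := is_derive_S _ t01.
(* The right side is the product rule for t^(1-p) S^p. *)
have -> : dPhi t = t `^ (1 - p) * (p * S t `^ (p - 1) * g t) +
                   S t `^ p * ((1 - p) * t `^ (1 - p - 1)).
  have SA : S t = t * A t by rewrite /A /average mulVKf ?gt_eqF.
  have tp : t `^ (1 - p) * t `^ (p - 1) = 1.
    rewrite -powRD ?(gt_eqF t0) ?implybT//.
    by rewrite (_ : 1 - p + (p - 1) = 0) ?powRr0//; ring.
  have tp' : t `^ (1 - p - 1) * t `^ p = 1.
    rewrite -powRD ?(gt_eqF t0) ?implybT//.
    by rewrite (_ : 1 - p - 1 + p = 0) ?powRr0//; ring.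
  rewrite SA !(powRM _ (ltW t0) (ltW At)) /dPhi.
  (* The factors [tp] and [tp'], both equal to 1, are inserted so that [ring] can match the two
     sides with the powers as atoms. *)
  transitivity (p * (A t `^ (p - 1) * g t) * (t `^ (1 - p) * t `^ (p - 1)) -
     (p - 1) * A t `^ p * (t `^ (1 - p - 1) * t `^ p)).
    by rewrite tp tp' !mulr1.
  ring.
have dS' : is_derive t 1 ((@powR R ^~ p) \o S) (p * S t `^ (p - 1) * g t).
  exact (is_derive1_comp (is_derive1_powR p St) dS).
have := is_deriveM (is_derive1_powR (1 - p) t0) dS'.
(* The product agrees with [Phi] on ]0, 1] by [PhiE], hence in a neighbourhood of t. *)
apply: near_eq_is_derive; near=> u; rewrite PhiE//.
have : u \in `]0, 1[ by near: u; exact: near_in_itvoo.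
exact: sub_oo.
Unshelve. all: by end_near. Qed.

Let cont_powR q (x : R) : 0 < x -> {for x, continuous (@powR R ^~ q)}.
Proof.
move=> x0; apply/differentiable_continuous/derivable1_diffP.
by have [] := is_derive1_powR q x0.
Qed.

Let cont_S t : t \in `]0, 1[ -> {for t, continuous S}.
Proof.
move=> t01; apply/differentiable_continuous/derivable1_diffP.
by have [] := is_derive_S _ t01.
Qed.

Let cont_A t : t \in `]0, 1[ -> {for t, continuous A}.
Proof.
move=> t01; apply: cvgM; last exact: cont_S.
by apply: cvgV => //; rewrite gt_eqF//; move: t01; rewrite in_itv/= => /andP[].
Qed.

Let cont_dPhi t : t \in `]0, 1[ -> {for t, continuous dPhi}.
Proof.
move=> t01; have At := A_gt0 _ (sub_oo _ t01).
have cA := cont_A _ t01.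
apply: cvgB; (apply: cvgM; first exact: cvg_cst);
  last exact: continuous_comp cA (cont_powR _ _ _).
by apply: cvgM; [exact: continuous_comp cA (cont_powR _ _ _)|exact: g_cont_at].
Qed.

Let int_dPhi a b : 0 < a -> a < b -> b < 1 ->
  mu.-integrable `[a, b] (EFin \o dPhi) /\
  (\int[mu]_(t in `[a, b]) (dPhi t)%:E = (Phi b - Phi a)%:E)%E.
Proof.
move=> a0 ab b1; have sub t : t \in `[a, b] -> t \in `]0, 1[.
  by rewrite !in_itv/= => /andP[ta tb]; rewrite (lt_le_trans a0)// (le_lt_trans tb).
have cd : {within `[a, b], continuous dPhi}.
  by apply: continuous_in_subspaceT => t /set_mem tab; exact/cont_dPhi/sub.
have cPhi t : t \in `[a, b] -> {for t, continuous Phi}.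
  move=> /sub t01; apply/differentiable_continuous/derivable1_diffP.
  by have [] := is_derive_Phi _ t01.
have ain : a \in `[a, b] by rewrite in_itv/= lexx ltW.
have bin : b \in `[a, b] by rewrite in_itv/= lexx ltW.
split.
  by apply: continuous_compact_integrable => //; exact: segment_compact.
rewrite (@continuous_FTC2 _ _ Phi _ _ ab cd) ?EFinB//.
- split.
  + by move=> t /subset_itv_oo_cc /sub /is_derive_Phi[].
  + exact/cvg_at_right_filter/cPhi.
  + exact/cvg_at_left_filter/cPhi.
- move=> t /subset_itv_oo_cc /sub /is_derive_Phi[_ <-].
  by rewrite derive1E.
Qed.

Lemma measurable_average : measurable_fun `](0 : R), 1] (average g).
Proof.
apply/measurable_fun_itv_bndo_bndcP; apply: open_continuous_measurable_fun.
  exact: interval_open.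
by move=> t /set_mem; exact: cont_A.
Qed.

Lemma average_gt0 t : t \in `]0, 1] -> 0 < average g t.
Proof. exact: A_gt0. Qed.

Let mEpow (h : R -> R) : measurable_fun `](0 : R), 1] h ->
  measurable_fun `](0 : R), 1] (fun t => (h t `^ p)%:E).
Proof.
by move=> mh; exact/measurable_EFinP/(measurableT_comp (measurable_powR _)).
Qed.

(* Jensen's inequality on [0, a], integrating the tangent of [x ^ p] at the mean. *)
Let Phi_le a : 0 < a -> a <= 1 ->
  ((Phi a)%:E <= \int[mu]_(t in `]0%R, a]) (g t `^ p)%:E)%E.
Proof.
move=> a0 a1; have a01 : a \in `]0, 1] by rewrite in_itv/= a0.
have Aa := ltW (A_gt0 _ a01).
have sa := sub01 _ a1.
have iga : mu.-integrable `](0 : R), a] (EFin \o g) by exact: integrableS ig.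
have ic (k : R) : mu.-integrable `](0 : R), a] (cst k%:E).
  rewrite -[cst _]/(EFin \o cst k).
  apply: (@integrableS _ _ _ mu `[0, a]) => //; first exact: subset_itv_oc_cc.
  by apply: continuous_compact_integrable => [|?];
    [exact: segment_compact|exact: cvg_cst].
pose k1 := p * A a `^ (p - 1); pose k0 := A a `^ p - k1 * A a.
have i1 : mu.-integrable `](0 : R), a] (EFin \o (fun t => k1 * g t)).
  exact: (integrableZl _ k1 iga).
(* The tangent line integrates to a (k1 A(a) + k0) = a A(a)^p, because g integrates to a A(a) over
   ]0, a]. *)
have <- : (\int[mu]_(t in `]0%R, a]) (k1 * g t + k0)%:E)%E = (Phi a)%:E.
  transitivity (\int[mu]_(t in `]0%R, a]) (k1%:E * (EFin \o g) t + cst k0%:E t))%E.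
    by apply: eq_integral => t _; rewrite EFinD EFinM.
  rewrite (integralD _ (integrableZl _ k1 iga) (ic k0))//.
  rewrite integralZl// -SE// integral_cst//= lebesgue_measure_itv/= lte_fin a0.
  rewrite oppr0 adde0 -!EFinM -EFinD; congr (_%:E).
  have -> : S a = a * A a by rewrite /A /average mulVKf ?gt_eqF.
  by rewrite /Phi /k0; ring.
apply: le_integral => //.
- have -> : (fun t => (k1 * g t + k0)%:E) =
    ((EFin \o (fun t => (k1 * g t)%R)) \+ cst k0%:E)%E by [].
  by apply: integrableD => //; exact: ic.
- exact: integrableS igp.
- move=> t /set_mem ta; rewrite lee_fin /k0 /k1.
  have t01 : t \in `]0, 1] by exact: sa.
  have := bregman_ge0 _ p_gt1 _ _ (g_ge0 _ t01) Aa.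
  rewrite /bregman; lra.
Qed.

Let cvg_e : (fun n => harmonic n / 3 : R) @ \oo --> 0.
Proof.
by rewrite -[X in _ --> X](mul0r 3^-1); apply: cvgM;
  [exact: cvg_harmonic|exact: cvg_cst].
Qed.

(** The pointwise identity is integrated over ]e_n, 1 - e_n] and n goes to infinity; the boundary
    terms tend to 0 and to f^p. It is stated in the extended reals, as the integral of A^p is not
    known to be finite beforehand: for c > 1 the identity itself shows this. *)
Lemma hardy_bregman_identity c : 1 <= c ->
  (\int[mu]_(t in `]0%R, 1%R]) (bregman p (c * g t) (average g t))%:E +
   ((c - 1) * (p - 1))%:E * \int[mu]_(t in `]0%R, 1%R]) (average g t `^ p)%:E =
   (c `^ p * F - c * f `^ p)%:E)%E.
Proof.
move=> c1; have c0 : 0 <= c by lra.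
have cp0 : 0 <= (c - 1) * (p - 1) by rewrite mulr_ge0 ?subr_ge0 ?(ltW p_gt1).
have mA := measurable_average.
pose K t := bregman p (c * g t) (A t) + (c - 1) * (p - 1) * A t `^ p.
have breg0 t : t \in `]0, 1] -> 0 <= bregman p (c * g t) (A t).
  by move=> t01; apply: bregman_ge0 => //;
    [rewrite mulr_ge0 ?g_ge0|exact/ltW/A_gt0].
have mbreg : measurable_fun `](0 : R), 1] (fun t => (bregman p (c * g t) (A t))%:E).
  apply/measurable_EFinP; rewrite /bregman.
  have mcg : measurable_fun `](0 : R), 1] (fun t => c * g t).
    exact: measurable_funM.
  have mpow q (h : R -> R) : measurable_fun `](0 : R), 1] h ->
      measurable_fun `](0 : R), 1] (fun t => h t `^ q).
    by move=> mh; exact: (measurableT_comp (measurable_powR _)).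
  apply: measurable_funB; first by apply: measurable_funB; exact: mpow.
  apply: measurable_funM; last exact: measurable_funB.
  by apply: measurable_funM => //; exact: mpow.
have mAp := mEpow _ mA.
have KE t : t \in `]0, 1] -> K t = c `^ p * g t `^ p - c * dPhi t.
  move=> t01; have At := ltW (A_gt0 _ t01).
  rewrite /K /bregman /dPhi powRM ?g_ge0// -(mulr_powRB1 At p_gt0); ring.
rewrite -ge0_integralZl//; last first.
  by move=> t _; rewrite lee_fin powR_ge0.
rewrite -ge0_integralD//; last 2 first.
  by move=> t _; rewrite mule_ge0// lee_fin powR_ge0.
  exact: measurable_funeM.
have K0 t : t \in `]0, 1] -> (0 <= (K t)%:E)%E.
  by move=> t01; rewrite lee_fin addr_ge0 ?breg0// mulr_ge0 ?powR_ge0.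
rewrite -[LHS]/(\int[mu]_(t in `]0%R, 1%R]) (K t)%:E)%E.
(* Division by 3 gives e n <= 1/3, hence e n < 1 - e n from n = 0 on. *)
pose e n : R := harmonic n / 3.
have e0 n : 0 < e n by rewrite divr_gt0// harmonic_gt0.
have e3 n : e n <= 3^-1.
  by rewrite /e ler_piMl// invf_le1// ler1n.
have eni : nonincreasing_seq e.
  move=> m n mn; rewrite /e ler_pM2r ?invr_gt0//.
  by rewrite /harmonic/= lef_pV2 ?posrE// ler_nat.
have sub n : `](e n), (1 - e n)] `<=` `](0 : R), 1].
  by apply: subset_itv; rewrite bnd_simp ?gerBl ltW.
have intK n : (\int[mu]_(t in `](e n), (1 - e n)%R]) (K t)%:E =
  (c `^ p)%:E * \int[mu]_(t in `](e n), (1 - e n)%R]) (g t `^ p)%:E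
  - (c * (Phi (1 - e n) - Phi (e n)))%:E)%E.
  have en := e0 n; have e3n := e3 n.
  have [id intd] : mu.-integrable `[e n, 1 - e n] (EFin \o dPhi) /\
      (\int[mu]_(t in `[e n, (1 - e n)%R]) (dPhi t)%:E =
        (Phi (1 - e n) - Phi (e n))%:E)%E.
    by apply: int_dPhi => //; lra.
  have id' : mu.-integrable `]e n, 1 - e n] (EFin \o dPhi).
    by apply: integrableS id => //; exact: subset_itv_oc_cc.
  have igp' : mu.-integrable `]e n, 1 - e n] (fun t => (g t `^ p)%:E).
    exact: integrableS igp.
  transitivity (\int[mu]_(t in `](e n), (1 - e n)%R])
      ((c `^ p * g t `^ p)%:E - (c * dPhi t)%:E))%E.
    by apply: eq_integral => t /set_mem /sub t01; rewrite KE// EFinB.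
  rewrite (@integralB_EFin _ _ _ mu _ (fun t => c `^ p * g t `^ p)
    (fun t => c * dPhi t))//.
  - under eq_integral do rewrite EFinM.
    under [X in (_ - X)%E]eq_integral do rewrite EFinM.
    rewrite (integralZl _ igp')// (integralZl _ id')//.
    rewrite (@integral_itv_obnd_cbnd _ _ _ (EFin \o dPhi)) ?intd ?EFinM//.
    exact: (measurable_int mu id').
  - exact: (integrableZl _ (c `^ p) igp').
  - exact: (integrableZl _ c id').
have cvgK : (\int[mu]_(t in `](e n), (1 - e n)%R]) (K t)%:E)%E @[n --> \oo] -->
    (\int[mu]_(t in `]0%R, 1%R]) (K t)%:E)%E.
  apply: cvg_integral_oo01 => //.
  exact: (emeasurable_funD mbreg (measurable_funeM ((c - 1) * (p - 1))%:E mAp)).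
have igp' n : mu.-integrable `]e n, 1 - e n] (fun t => (g t `^ p)%:E).
  exact: integrableS igp.
pose G n := fine (\int[mu]_(t in `](e n), (1 - e n)%R]) (g t `^ p)%:E)%E.
have GE n : (G n)%:E = (\int[mu]_(t in `](e n), (1 - e n)%R]) (g t `^ p)%:E)%E.
  by rewrite fineK// integrable_fin_num.
have cvgG : G @ \oo --> F.
  apply: fine_cvg; rewrite -int_gp; apply: cvg_integral_oo01 => //;
    first exact: mEpow.
  by move=> t _; rewrite lee_fin powR_ge0.
(* By Jensen, [Phi (e n)] is at most the integral of g^p over ]0, e n], hence at most F - G n, the
   intervals ]0, e n] and ]e n, 1 - e n] being disjoint in ]0, 1]. *)
have cvg_Phi0 : Phi (e n) @[n --> \oo] --> 0.
  have FG0 : F - G n @[n --> \oo] --> 0.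
    by rewrite -(subrr F); apply: cvgB => //; exact: cvg_cst.
  apply: (squeeze_cvgr _ (cvg_cst 0) FG0); apply: nearW => n.
  have en1 : e n <= 1 by have := e3 n; lra.
  rewrite mulr_ge0 ?powR_ge0 ?(ltW (e0 n))//= lerBrDr -lee_fin EFinD GE.
  apply: (le_trans (leeD2r _ (Phi_le _ (e0 n) en1))).
  rewrite -integral_split//; last 3 first.
    by have := e3 n; lra.
    by apply: measurable_funS (mEpow _ mg) => //; apply: sub01; rewrite gerBl ltW.
    by move=> t _; rewrite lee_fin powR_ge0.
  rewrite -int_gp; apply: ge0_subset_integral => //; first exact: mEpow.
    by move=> t _; rewrite lee_fin powR_ge0.
  by apply: sub01; rewrite gerBl ltW.
(* S (1 - e n) lies between the integral of g over ]e n, 1 - e n] and f. *)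
have cvg_S1 : S (1 - e n) @[n --> \oo] --> f.
  have cvgg : fine (\int[mu]_(t in `](e n), (1 - e n)%R]) (g t)%:E)%E
      @[n --> \oo] --> f.
    apply: fine_cvg; rewrite -int_g; apply: cvg_integral_oo01 => //.
    exact/measurable_EFinP.
  apply: (squeeze_cvgr _ cvgg (cvg_cst f)); apply: nearW => n.
  have ig' : mu.-integrable `]e n, 1 - e n] (EFin \o g) by exact: integrableS ig.
  have le1 : 1 - e n <= 1 by rewrite gerBl ltW.
  rewrite -!lee_fin fineK ?integrable_fin_num// SE// -int_g.
  apply/andP; split; apply: ge0_subset_integral => //=.
  - apply/measurable_EFinP; apply: measurable_funS mg => //; exact: sub01.
  - by move=> t /(sub01 _ le1) t01; rewrite lee_fin g_ge0.
  - by apply: subset_itvr; rewrite bnd_simp ltW.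
  - exact/measurable_EFinP.
  - exact: sub01.
have cvg_Phi1 : Phi (1 - e n) @[n --> \oo] --> f `^ p.
  have -> : (fun n => Phi (1 - e n)) =
      (fun n => (1 - e n) `^ (1 - p) * S (1 - e n) `^ p).
    apply/funext => n; rewrite PhiE// in_itv/= gerBl (ltW (e0 n)) andbT.
    by have := e3 n; lra.
  have -> : f `^ p = (1 : R) `^ (1 - p) * f `^ p by rewrite powR1 mul1r.
  apply: cvgM; last exact: (cvg_comp _ _ cvg_S1 (cont_powR p _ f_gt0)).
  have cvg_1e : 1 - e n @[n --> \oo] --> (1 : R).
    by have := cvgB (cvg_cst (1 : R)) cvg_e; rewrite subr0; apply.
  exact: (cvg_comp _ _ cvg_1e (cont_powR (1 - p) _ ltr01)).
have intK' n : (\int[mu]_(t in `](e n), (1 - e n)%R]) (K t)%:E)%E =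
    (c `^ p * G n - c * (Phi (1 - e n) - Phi (e n)))%:E.
  by rewrite intK -GE -EFinM -EFinB.
move: cvgK; rewrite (funext intK') => cvgK.
rewrite -(cvg_lim (@ereal_hausdorff R) cvgK); apply: cvg_lim => //.
apply: cvg_EFin; first exact: nearW.
apply: cvgB; first by apply: cvgM => //; exact: cvg_cst.
apply: cvgM; first exact: cvg_cst.
by rewrite -[X in _ --> X]subr0; exact: cvgB.
Qed.

End hardy_identity.

(** * The inverse of H_p *)

(** [pinv] is a right inverse with values in the interval as soon as H_p maps that interval onto
    [0, 1]. This is the intermediate value theorem between H_p(1) = 1 and H_p(p / (p - 1)) = 0. *)
Lemma omega_spec {R : realType} (p x : R) : 1 < p -> 0 <= x <= 1 ->
  1 <= omega p x /\ Hp p (omega p x) = x.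
Proof.
move=> p1 /andP[x0 x1]; have pp : 1 <= p / (p - 1).
  by rewrite ler_pdivlMr ?subr_gt0// mul1r gerBl; lra.
have surj : set_surj `[1, p / (p - 1)] `[(0 : R), 1] (Hp p).
  move=> y /=; rewrite in_itv/= => /andP[y0 y1].
  have cont : {within `[1, p / (p - 1)], continuous (Hp p)}.
    apply: continuous_in_subspaceT => z /set_mem /=; rewrite in_itv/= => /andP[z1 _].
    have z0 : 0 < z by lra.
    have cpow q : {for z, continuous (@powR R ^~ q)}.
      apply/differentiable_continuous/derivable1_diffP.
      by have [] := is_derive1_powR q z0.
    by apply: cvgD; (apply: cvgM; [exact: cvg_cst|exact: cpow]).
  have H1 : Hp p 1 = 1 by rewrite /Hp !powR1; ring.
  have H2 : Hp p (p / (p - 1)) = 0.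
    have [pp0 p0] : 0 <= p / (p - 1) /\ 0 < p by lra.
    rewrite /Hp -(mulr_powRB1 pp0 p0); set y' := _ `^ _.
    by field; lra.
  have [|z zin <-] := @IVT _ _ _ _ y pp cont; last by exists z.
  by rewrite H1 H2 ge_min le_max y0 y1 orbT.
have xin : `[(0 : R), 1]%classic x by rewrite /= in_itv/= x0.
split; last by apply: (surjpK _ surj); rewrite inE.
have : (`[1, p / (p - 1)]%classic : set R) (omega p x).
  by apply: (surjpinv_image_sub surj); exists x.
by rewrite /= in_itv/= => /andP[].
Qed.

(** * Integrated comparisons between A and c g *)

Section comparison.
Context {R : realType}.
Variables (p f F : R) (g : R -> R).
Local Notation mu := (@lebesgue_measure R).
Hypothesis p_gt1 : 1 < p.
Hypothesis f_gt0 : 0 < f.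
Hypothesis g_ge0 : forall t, t \in `]0, 1] -> 0 <= g t.
Hypothesis g_noninc : {in `]0, 1] &, {homo g : x y /~ x <= y}}.
Hypothesis g_cont : {within `]0, 1], continuous g}.
Hypothesis int_g : (\int[mu]_(u in `]0%R, 1%R]) (g u)%:E)%E = f%:E.
Hypothesis int_gp : (\int[mu]_(u in `]0%R, 1%R]) (g u `^ p)%:E)%E = F%:E.
Variable c : R.
Hypothesis c_ge0 : 0 <= c.

Let D : set R := `]0, 1]%classic.

Let mD : measurable D. Proof. exact: measurable_itv. Qed.

(** Transfers pointwise linear bounds to integrals; nonnegativity gives additivity even where an
    integral is infinite. *)
Let le_lin a b (h u v : R -> R) : 0 <= a -> 0 <= b ->
  measurable_fun D h -> measurable_fun D u -> measurable_fun D v ->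
  (forall t, D t -> 0 <= h t) -> (forall t, D t -> 0 <= u t) ->
  (forall t, D t -> 0 <= v t) ->
  (forall t, D t -> h t <= a * u t + b * v t) ->
  (\int[mu]_(t in D) (h t)%:E <=
   a%:E * \int[mu]_(t in D) (u t)%:E + b%:E * \int[mu]_(t in D) (v t)%:E)%E.
Proof.
move=> a0 b0 mh mu_ mv h0 u0 v0 huv.
have mh' : measurable_fun D (EFin \o h) by exact/measurable_EFinP.
have mu' : measurable_fun D (EFin \o u) by exact/measurable_EFinP.
have mv' : measurable_fun D (EFin \o v) by exact/measurable_EFinP.
have mau : measurable_fun D (fun t => a%:E * (u t)%:E)%E by exact: measurable_funeM.
have mbv : measurable_fun D (fun t => b%:E * (v t)%:E)%E by exact: measurable_funeM.
have au0 t : D t -> (0 <= a%:E * (u t)%:E)%E.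
  by move=> Dt; rewrite mule_ge0// lee_fin u0.
have bv0 t : D t -> (0 <= b%:E * (v t)%:E)%E.
  by move=> Dt; rewrite mule_ge0// lee_fin v0.
rewrite -ge0_integralZl// -ge0_integralZl// -ge0_integralD//.
apply: ge0_le_integral => //; first exact: emeasurable_funD.
Qed.

Local Notation I := (\int[mu]_(t in D) (average g t `^ p)%:E)%E.
Local Notation J := (\int[mu]_(t in D) (`|average g t - c * g t| `^ p)%:E)%E.
Local Notation B := (\int[mu]_(t in D) (bregman p (c * g t) (average g t))%:E)%E.
Local Notation L := (c `^ p * F).

Let mg : measurable_fun D g.
Proof. exact: (subspace_continuous_measurable_fun mD). Qed.

Let mA : measurable_fun D (average g).
Proof. exact: (measurable_average f g g_ge0 g_cont int_g). Qed.

Let A_ge0 t : D t -> 0 <= average g t.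
Proof. by move=> Dt; apply/ltW/(average_gt0 f g). Qed.

Let cg_ge0 t : D t -> 0 <= c * g t.
Proof. by move=> Dt; rewrite mulr_ge0// g_ge0. Qed.

Let mcg : measurable_fun D (fun t => c * g t).
Proof. exact: measurable_funM. Qed.

Let mpow q (h : R -> R) : measurable_fun D h ->
  measurable_fun D (fun t => h t `^ q).
Proof. by move=> mh; exact: (measurableT_comp (measurable_powR _)). Qed.

Let mdist : measurable_fun D (fun t => `|average g t - c * g t|).
Proof. by apply: measurableT_comp => //; exact: measurable_funB. Qed.

Let mbreg : measurable_fun D (fun t => bregman p (c * g t) (average g t)).
Proof.
apply: measurable_funB; first by apply: measurable_funB; exact: mpow.
apply: measurable_funM; last exact: measurable_funB.
by apply: measurable_funM => //; exact: mpow.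
Qed.

Let int_cg : (\int[mu]_(t in D) ((c * g t) `^ p)%:E = L%:E)%E.
Proof.
have mgp : measurable_fun D (fun t => (g t `^ p)%:E).
  by apply/measurable_EFinP; exact (mpow p g mg).
rewrite EFinM -int_gp -ge0_integralZl//; last 2 first.
- by move=> t _; rewrite lee_fin powR_ge0.
- by rewrite lee_fin powR_ge0.
by apply: eq_integral => t /set_mem Dt; rewrite powRM// g_ge0.
Qed.

Lemma dist_le_bregman e C : 0 <= e -> 0 <= C ->
  (forall a b, 0 <= a -> 0 <= b ->
    `|a - b| `^ p <= e * (a `^ p + b `^ p) + C * bregman p b a) ->
  (J <= e%:E * (I + L%:E) + C%:E * B)%E.
Proof.
move=> e0 C0 H.
have -> : (I + L%:E = \int[mu]_(t in D) (average g t `^ p + (c * g t) `^ p)%:E)%E.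
  have mAp : measurable_fun D (fun t => (average g t `^ p)%:E).
    by apply/measurable_EFinP; exact (mpow p _ mA).
  have mcgp : measurable_fun D (fun t => ((c * g t) `^ p)%:E).
    by apply/measurable_EFinP; exact (mpow p _ mcg).
  by rewrite -int_cg -ge0_integralD// => t _; rewrite lee_fin powR_ge0.
apply: le_lin => //.
- exact: mpow.
- by apply: measurable_funD; exact: mpow.
- by move=> t Dt; rewrite addr_ge0 ?powR_ge0.
- by move=> t Dt; apply: bregman_ge0; [|exact: cg_ge0|exact: A_ge0].
- by move=> t Dt; apply: H; [exact: A_ge0|exact: cg_ge0].
Qed.

Lemma average_le_dist e C : 0 <= e -> 0 <= C ->
  (forall a b, 0 <= a -> 0 <= b ->
    a `^ p <= (1 + e) * b `^ p + C * `|a - b| `^ p) ->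
  (I <= (1 + e)%:E * L%:E + C%:E * J)%E /\ (L%:E <= (1 + e)%:E * I + C%:E * J)%E.
Proof.
move=> e0 C0 H; have e1 : 0 <= 1 + e by lra.
rewrite -int_cg; split; apply: le_lin => //; try exact: mpow;
  try by move=> t _; exact: powR_ge0.
- by move=> t Dt; apply: H; [exact: A_ge0|exact: cg_ge0].
- by move=> t Dt; rewrite distrC; apply: H; [exact: cg_ge0|exact: A_ge0].
Qed.

End comparison.

(** * Limit arguments for extended real sequences *)

Section limits.
Context {R : realType}.
Variables (I J : (\bar R)^nat) (L : R).
Hypothesis L_ge0 : 0 <= L.
Hypothesis I_ge0 : forall n, (0 <= I n)%E.
Hypothesis J_ge0 : forall n, (0 <= J n)%E.

(** The factor 2 L + 1 bounds I_n + L once I_n <= L + 1 in the first lemma below, and bounds I_n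
    itself in the second, so that each error term is at most e / 2. *)
Let half e : 0 < e -> let d := e / (2 * (2 * L + 1)) in
  0 < d /\ d * (2 * L + 1) = e / 2.
Proof.
move=> e0 d; have L1 : 0 < 2 * L + 1 by rewrite ltr_wpDl// mulr_ge0.
split; first by rewrite divr_gt0// mulr_gt0.
by rewrite /d; field; rewrite gt_eqF.
Qed.

(** The quantity k L - k I_n stands for the integral of the divergence and tends to 0 with I_n -> L.
    As C is fixed before n, the product with C is eventually at most e / 2. *)
Lemma cvg_fluctuation0 (k : R) : I @ \oo --> L%:E ->
  (forall e, 0 < e -> exists2 C, 0 < C & forall n, I n \is a fin_num ->
    (J n <= (e * (fine (I n) + L) + C * (k * L - k * fine (I n)))%:E)%E) ->
  J @ \oo --> 0%E.
Proof.
move=> /fine_cvgP[fin_cvg cvg] J_le.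
have cvgkI : k * L - k * fine (I n) @[n --> \oo] --> 0.
  rewrite -[X in _ --> X](subrr (k * L)).
  by apply: cvgB; [exact: cvg_cst|apply: cvgM => //; exact: cvg_cst].
apply/fine_cvgP; split.
  (* Any fixed e makes J n finite wherever I n is. *)
  have [C C0 JC] := J_le 1 ltr01.
  near=> n; rewrite ge0_fin_numE//; apply: le_lt_trans (JC n _) (ltry _).
  by near: n.
apply/cvgrPdist_le => e e0; have [d0 dL] := half e e0.
have [C C0 JC] := J_le _ d0.
near=> n.
have finI : I n \is a fin_num by near: n.
have I_le : fine (I n) <= L + 1.
  by near: n; apply: (cvgr_le L) => //; rewrite ltrDl.
have kI_le : k * L - k * fine (I n) <= e / 2 / C.
  by near: n; apply: (cvgr_le 0) => //; rewrite !divr_gt0.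
have finJ : J n \is a fin_num.
  by rewrite ge0_fin_numE//; apply: le_lt_trans (JC n finI) (ltry _).
rewrite sub0r normrN ger0_norm ?fine_ge0//.
rewrite -lee_fin fineK//; apply: le_trans (JC n finI) _.
rewrite lee_fin [leRHS]splitr lerD//.
  by rewrite -dL ler_pM2l//; move: I_le; lra.
by rewrite mulrC -ler_pdivlMr.
Unshelve. all: by end_near. Qed.

Lemma cvg_of_fluctuation : J @ \oo --> 0%E ->
  (forall e, 0 < e -> exists2 C, 0 < C & forall n,
    (I n <= (1 + e)%:E * L%:E + C%:E * J n)%E /\
    (L%:E <= (1 + e)%:E * I n + C%:E * J n)%E) ->
  I @ \oo --> L%:E.
Proof.
move=> /fine_cvgP[fin_cvg cvg] I_leE.
have I_le e : 0 < e -> exists2 C, 0 < C & forall n, J n \is a fin_num ->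
    [/\ I n \is a fin_num, fine (I n) <= (1 + e) * L + C * fine (J n) &
       L <= (1 + e) * fine (I n) + C * fine (J n)].
  move=> e0; have [C C0 HC] := I_leE e e0.
  exists C => // n finJ; have [] := HC n.
  rewrite -(fineK finJ) -!EFinM -EFinD => h1 h2.
  have finI : I n \is a fin_num.
    by rewrite ge0_fin_numE//; apply: le_lt_trans h1 (ltry _).
  split=> //=; first by rewrite -lee_fin fineK.
  by rewrite -lee_fin EFinD (EFinM (1 + e)) fineK.
(* The instance e = 1 gives the a priori bound I_n <= 2 L + 1 once C1 J_n <= 1. The lower estimate
   relies on it, since its error d I_n involves I_n itself. *)
have [C1 C1_gt0 IC1] := I_le 1 ltr01.
apply/fine_cvgP; split.
  by near=> n; have [] := IC1 n _; first by near: n.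
apply/cvgrPdist_le => e e0; have [d0 dM] := half e e0.
set d := e / _ in d0 dM; have [C C0 IC] := I_le d d0.
near=> n.
have finJ : J n \is a fin_num by near: n.
have [_ hI1 _] := IC1 n finJ; have [_ h1 h2] := IC n finJ.
have J1 : C1 * fine (J n) <= 1.
  rewrite mulrC -ler_pdivlMr// mul1r.
  by near: n; apply: (cvgr_le 0) => //; rewrite invr_gt0.
have J2 : C * fine (J n) <= e / 2.
  rewrite mulrC -ler_pdivlMr//.
  by near: n; apply: (cvgr_le 0) => //; rewrite !divr_gt0.
have dI : d * fine (I n) <= e / 2.
  by rewrite -dM ler_pM2l//; move: hI1 J1; lra.
have dL : d * L <= e / 2 by rewrite -dM ler_pM2l//; move: L_ge0; lra.
rewrite ler_norml /=; apply/andP; split.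
  by move: h1 J2 dL; rewrite mulrDl mul1r; lra.
by move: h2 J2 dI; rewrite mulrDl mul1r; lra.
Unshelve. all: by end_near. Qed.

End limits.

(** * The equivalence for the sequence g_n *)

Theorem theorem1 (R : realType) (p f F : R) (g : nat -> R -> R)
  (p_gt1 : 1 < p) (f_gt0 : 0 < f) (fF : f `^ p <= F)
  (g_ge0 : forall n t, t \in `]0, 1] -> 0 <= g n t)
  (g_noninc : forall n, {in `]0, 1] &, {homo g n : x y /~ x <= y}})
  (g_cont : forall n, {within `]0, 1], continuous (g n)})
  (int_g : forall n,
    (\int[lebesgue_measure]_(u in `]0%R, 1%R]) (g n u)%:E)%E = f%:E)
  (int_gp : forall n,
    (\int[lebesgue_measure]_(u in `]0%R, 1%R]) (g n u `^ p)%:E)%E = F%:E) :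
  let c := omega p (f `^ p / F) in
  ((fun n => (\int[lebesgue_measure]_(t in `]0%R, 1%R])
                (average (g n) t `^ p)%:E)%E) @ \oo
     --> (F * omega p (f `^ p / F) `^ p)%:E)
  <->
  ((fun n => (\int[lebesgue_measure]_(t in `]0%R, 1%R])
                (`|average (g n) t - c * g n t| `^ p)%:E)%E) @ \oo
     --> 0%E).
Proof.
move=> c.
have p_gt0 : 0 < p by lra.
have fp_gt0 : 0 < f `^ p by rewrite powR_gt0.
have F_gt0 : 0 < F := lt_le_trans fp_gt0 fF.
have x01 : 0 <= f `^ p / F <= 1.
  by rewrite divr_ge0 ?(ltW fp_gt0) ?(ltW F_gt0)//= ler_pdivrMr// mul1r.
have [c_ge1 Hc] := omega_spec p _ p_gt1 x01; rewrite -/c in c_ge1 Hc *.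
have c_ge0 : 0 <= c by lra.
pose L := c `^ p * F; pose k := (c - 1) * (p - 1).
have L_ge0 : 0 <= L by rewrite mulr_ge0 ?powR_ge0// ltW.
have kL : c `^ p * F - c * f `^ p = k * L.
  have -> : f `^ p = F * Hp p c by rewrite Hc mulrC divfK// gt_eqF.
  by rewrite /Hp /L /k -(mulr_powRB1 c_ge0 p_gt0); ring.
rewrite [F * _]mulrC -/L.
pose I n := (\int[lebesgue_measure]_(t in `]0%R, 1%R])
  (average (g n) t `^ p)%:E)%E.
pose J n := (\int[lebesgue_measure]_(t in `]0%R, 1%R])
  (`|average (g n) t - c * g n t| `^ p)%:E)%E.
pose B n := (\int[lebesgue_measure]_(t in `]0%R, 1%R])
  (bregman p (c * g n t) (average (g n) t))%:E)%E.
have IB n : (B n + k%:E * I n = (k * L)%:E)%E.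
  rewrite -kL; exact: (hardy_bregman_identity p f F (g n) p_gt1 f_gt0
    (g_ge0 n) (g_noninc n) (g_cont n) (int_g n) (int_gp n) c c_ge1).
have I_ge0 n : (0 <= I n)%E.
  by apply: integral_ge0 => t _; rewrite lee_fin powR_ge0.
have J_ge0 n : (0 <= J n)%E.
  by apply: integral_ge0 => t _; rewrite lee_fin powR_ge0.
split=> [I_cvg|J_cvg].
- apply: (cvg_fluctuation0 I J L L_ge0 J_ge0 k I_cvg) => e e0.
  have [C C0 HC] := distr_powR_le_bregman p p_gt1 e e0.
  exists C => // n finI.
  (* Finiteness of I n permits the subtraction in the extended-real identity, which turns the
     divergence integral into k (L - I_n). *)
  have BE : (k * L - k * fine (I n))%:E = B n.
    by rewrite EFinB -(IB n) (EFinM k (fine _)) fineK// addeK// fin_numM.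
  rewrite EFinD !EFinM BE EFinD fineK//.
  exact: (dist_le_bregman p f F (g n) p_gt1 f_gt0 (g_ge0 n) (g_noninc n)
    (g_cont n) (int_g n) (int_gp n) c c_ge0 e C (ltW e0) (ltW C0) HC).
- apply: (cvg_of_fluctuation I J L L_ge0 I_ge0 J_cvg) => e e0.
  have [C C0 HC] := powR_le_distr p p_gt1 e e0.
  exists C => [//|n].
  exact (average_le_dist p f F (g n) f_gt0 (g_ge0 n) (g_noninc n)
    (g_cont n) (int_g n) (int_gp n) c c_ge0 e C (ltW e0) (ltW C0) HC).
Qed.
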